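(* Let $n\ge 1$ and let $a=(a_1,\dots,a_n)$ be a sequence of positive integers, with partial sums $\sigma_i=a_1+\cdots+a_i$. Let $t_{ij}$ ($1\le i<j\le n$) be indeterminates. Then \[ \mathrm{CT}\bigg[\prod_{1\leq i<j\leq n}(x_i/x_j;q)_{a_i}(qx_j/x_i;q)_{a_j-1}(1-t_{ij}x_j/x_i)\bigg]=W_a(\boldsymbol{t})\prod_{i=1}^n\begin{bmatrix}\sigma_i-1\\ a_i-1\end{bmatrix}_q, \] where \[ W_a(\boldsymbol{t})=\sum_{w\in\mathfrak{S}_n}\Big(\prod_{(i,j)\in R(w)}t_{ij}\Big)\prod_{i=1}^n\frac{1-q^{\sigma_i}}{1-q^{a_{w(1)}+\cdots+a_{w(i)}}}. \]
   Context: $\mathrm{CT}$ denotes the constant term in $x_1,\dots,x_n$ of a Laurent polynomial in $x_1,\dots,x_n$ (with coefficients polynomials in $q$ and the $t_{ij}$); the identity holds in $\mathbb{Q}(q)[t_{ij}]$. $(a;q)_k=\prod_{i=0}^{k-1}(1-aq^i)$; $\begin{bmatrix} n\\ m\end{bmatrix}_q=\frac{(q;q)_n}{(q;q)_m(q;q)_{n-m}}$ for $0\le m\le n$ and $0$ otherwise. $\mathfrak{S}_n$ is the symmetric group, and for $w\in\mathfrak{S}_n$, $R(w)=\{(w(j),w(i)):\ 1\le i<j\le n,\ w(j)<w(i)\}$ (the inversion set of $w^{-1}$). *)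

(* Defs.v *)
From HB Require Import structures.
From mathcomp Require Import all_boot all_order all_algebra all_fingroup.
From mathcomp Require Import finmap.
From mathcomp.multinomials Require Import mpoly.
From mathcomp.multinomials Require Import (canonicals) monalg.

Set Implicit Arguments.
Unset Strict Implicit.
Unset Printing Implicit Defensive.

Import GRing.Theory.

Local Open Scope ring_scope.

(* Laurent polynomials in n variables over R, as finitely supported functions *)
(* from exponent vectors in Z^n to R. The ring instance of monalg does not    *)
(* apply, since its exponent monoids have no invertible element except 1.     *)
Definition laurent (n : nat) (R : comNzRingType) : Type :=
  monalg.malg 'rV[int]_n R.

Section LaurentRing.
Variables (n : nat) (R : comNzRingType).

HB.instance Definition _ := GRing.Lmodule.on (laurent n R).

Implicit Types (e : 'rV[int]_n) (c : R) (f g h : laurent n R).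

Definition lcoef e f : R := monalg.mcoeff e f.
(* lterm and lmul are locked so that unification does not unfold them. *)
Fact lterm_key : unit. Proof. by []. Qed.
Definition lterm : R -> 'rV[int]_n -> laurent n R :=
  locked_with lterm_key (fun c e => monalg.mkmalgU e c).
Definition lsupp f : {fset 'rV[int]_n} := monalg.msupp f.

Lemma ltermE c e : lterm c e = monalg.mkmalgU e c.
Proof. by rewrite /lterm unlock. Qed.

Lemma laurentP f g : (forall e, lcoef e f = lcoef e g) <-> f = g.
Proof. exact: monalg.malgP. Qed.

Lemma lcoef_is_zmod_morphism e : zmod_morphism (lcoef e).
Proof. exact: monalg.mcoeffB. Qed.

HB.instance Definition _ e :=
  GRing.isZmodMorphism.Build (laurent n R) R (lcoef e)
    (lcoef_is_zmod_morphism e).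

Lemma lcoef_is_scalable e : scalable_for *%R (lcoef e).
Proof. by move=> c f; rewrite /lcoef monalg.mcoeffZ. Qed.

HB.instance Definition _ e :=
  GRing.isScalable.Build R (laurent n R) R *%R (lcoef e)
    (lcoef_is_scalable e).

Lemma lcoef_term e c e' : lcoef e' (lterm c e) = c *+ (e == e').
Proof. by rewrite ltermE; apply: monalg.mcoeffU. Qed.

Lemma lterm0 e : lterm 0 e = 0.
Proof. by rewrite ltermE; apply: monalg.monalgU0. Qed.

Lemma ltermD e c c' : lterm (c + c') e = lterm c e + lterm c' e.
Proof. by rewrite !ltermE; apply: monalg.monalgUD. Qed.

Lemma lsuppE e f : (e \in lsupp f) = (lcoef e f != 0).
Proof. by rewrite /lcoef monalg.mcoeff_neq0. Qed.

Lemma laurentE f (d : {fset 'rV[int]_n}) : (lsupp f `<=` d)%fset ->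
  f = \sum_(e <- d) lterm (lcoef e f) e.
Proof.
move=> /(@monalg.monalgEw _ _ f) {1}->.
by apply: eq_bigr => e _; rewrite ltermE.
Qed.

Lemma lsupp_term c e : (lsupp (lterm c e) `<=` [fset e])%fset.
Proof. by rewrite ltermE; apply: monalg.msuppU_le. Qed.

Definition lone : laurent n R := lterm 1 0.

Fact lmul_key : unit. Proof. by []. Qed.
Definition lmul : laurent n R -> laurent n R -> laurent n R :=
  locked_with lmul_key (fun f g =>
    \sum_(e <- lsupp f) \sum_(e' <- lsupp g)
      lterm (lcoef e f * lcoef e' g) (e + e')).

Lemma lmulE f g : lmul f g =
  \sum_(e <- lsupp f) \sum_(e' <- lsupp g)
    lterm (lcoef e f * lcoef e' g) (e + e').
Proof. by rewrite /lmul unlock. Qed.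

Lemma lmulw (d d' : {fset 'rV[int]_n}) f g :
  (lsupp f `<=` d)%fset -> (lsupp g `<=` d')%fset ->
  lmul f g = \sum_(e <- d) \sum_(e' <- d')
    lterm (lcoef e f * lcoef e' g) (e + e').
Proof.
move=> fd gd'; rewrite lmulE (big_fset_incl _ fd) /=.
  apply: eq_bigr => e _; apply: big_fset_incl => // e' _.
  by rewrite lsuppE negbK => /eqP->; rewrite mulr0 lterm0.
move=> e _; rewrite lsuppE negbK => /eqP->.
by rewrite big1 // => e' _; rewrite mul0r lterm0.
Qed.

Lemma lmulC : commutative lmul.
Proof.
move=> f g; rewrite !lmulE exchange_big.
by apply: eq_bigr => e _; apply: eq_bigr => e' _; rewrite mulrC addrC.
Qed.

Lemma lsuppD f g : (lsupp (f + g)%R `<=` lsupp f `|` lsupp g)%fset.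
Proof. exact: monalg.msuppD_le. Qed.

Lemma lmulDl : left_distributive lmul +%R.
Proof.
move=> f g h.
rewrite (lmulw (lsuppD f g) (fsubset_refl (lsupp h))).
rewrite (lmulw (fsubsetUl (lsupp f) (lsupp g)) (fsubset_refl (lsupp h))).
rewrite (lmulw (fsubsetUr (lsupp f) (lsupp g)) (fsubset_refl (lsupp h))).
rewrite -big_split; apply: eq_bigr => e _.
rewrite -big_split; apply: eq_bigr => e' _.
by rewrite raddfD mulrDl ltermD.
Qed.

Lemma lmul0 : left_zero 0 lmul.
Proof. by move=> g; rewrite lmulE /lsupp monalg.msupp0 big_seq_fset0. Qed.

Lemma lmul_sum (I : Type) (r : seq I) (F : I -> laurent n R) g :
  lmul (\sum_(i <- r) F i) g = \sum_(i <- r) lmul (F i) g.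
Proof. exact: (big_morph (lmul^~ g) (fun _ _ => lmulDl _ _ _) (lmul0 g)). Qed.

Lemma lmul_term c e c' e' :
  lmul (lterm c e) (lterm c' e') = lterm (c * c') (e + e').
Proof.
rewrite (lmulw (lsupp_term _ _) (lsupp_term _ _)) !big_seq_fset1.
by rewrite !lcoef_term !eqxx.
Qed.

Lemma lmul_sumr (I : Type) (r : seq I) (F : I -> laurent n R) g :
  lmul g (\sum_(i <- r) F i) = \sum_(i <- r) lmul g (F i).
Proof. by rewrite lmulC lmul_sum; apply: eq_bigr => i _; apply: lmulC. Qed.

Lemma lmulA : associative lmul.
Proof.
move=> f g h.
rewrite [f](laurentE (fsubset_refl _)) !lmul_sum; apply: eq_bigr => e _.
rewrite [g](laurentE (fsubset_refl _)) lmul_sum !lmul_sumr lmul_sum.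
apply: eq_bigr => e' _.
rewrite [h](laurentE (fsubset_refl _)) !lmul_sumr; apply: eq_bigr => e'' _.
by rewrite !lmul_term mulrA addrA.
Qed.

Lemma lmul1 : left_id lone lmul.
Proof.
move=> f; rewrite lmulC [f](laurentE (fsubset_refl _)) lmul_sum.
by apply: eq_bigr => e _; rewrite lmul_term mulr1 addr0.
Qed.

Lemma lone_neq0 : lone != 0.
Proof.
apply/eqP => /laurentP/(_ 0); rewrite lcoef_term eqxx raddf0 => /eqP.
by rewrite oner_eq0.
Qed.

HB.instance Definition _ := GRing.Zmodule_isComNzRing.Build (laurent n R)
  lmulA lmulC lmul1 lmulDl lone_neq0.

Lemma lscale_term c c' e : c *: lterm c' e = lterm (c * c') e.
Proof.
by apply/laurentP => e'; rewrite lcoef_is_scalable !lcoef_term mulrnAr.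
Qed.

Lemma lscaleAl c f g : c *: (f * g) = (c *: f) * g.
Proof.
have scE h : c *: h = lterm c 0 * h.
  rewrite [h](laurentE (fsubset_refl _)) scaler_sumr mulr_sumr.
  apply: eq_bigr => e _; rewrite lscale_term.
  by rewrite [RHS]lmul_term add0r.
by rewrite !scE mulrA.
Qed.

HB.instance Definition _ :=
  GRing.Lmodule_isLalgebra.Build R (laurent n R) lscaleAl.
HB.instance Definition _ := GRing.Lalgebra_isComAlgebra.Build R (laurent n R).

Definition lmonom e : laurent n R := lterm 1 e.

Lemma lmonom0 : lmonom 0 = 1.
Proof. by []. Qed.

Lemma lmonomD e e' : lmonom (e + e') = lmonom e * lmonom e'.
Proof. by rewrite [RHS]lmul_term mulr1. Qed.

(* x_i / x_j *)
Definition xratio (i j : 'I_n) : laurent n R :=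
  lmonom (delta_mx 0 i - delta_mx 0 j).

Lemma xratioV (i j : 'I_n) : xratio i j * xratio j i = 1.
Proof.
rewrite /xratio -lmonomD -[X in lmonom (_ + X)]opprB subrr; exact: lmonom0.
Qed.

Definition CT f : R := lcoef 0 f.

End LaurentRing.

Definition qpoch (R : comNzRingType) (x q : R) (k : nat) : R :=
  \prod_(i < k) (1 - x * q ^+ i).

Definition qbinom (F : fieldType) (q : F) (n m : nat) : F :=
  if (m <= n)%N then qpoch q q n / (qpoch q q m * qpoch q q (n - m)) else 0.

Definition Qq : fieldType := {fraction {poly rat}}.
Definition qvar : Qq := FracField.tofrac 'X.

Definition ltpair (n : nat) : finType := {p : 'I_n * 'I_n | (p.1 < p.2)%N}.

(* Q(q)[t_ij : i < j], with one indeterminate for each pair i < j *)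
Definition coefring (n : nat) : comNzRingType := {mpoly Qq[#|ltpair n|]}.
Definition tvar (n : nat) (p : ltpair n) : coefring n := 'X_(enum_rank p).
Definition qcst (n : nat) (c : Qq) : coefring n := c%:MP.

Definition sigma (n : nat) (a : 'I_n -> nat) (i : 'I_n) : nat :=
  \sum_(k < n | (k <= i)%N) a k.

(* Every pair in Rset w has its first component smaller than its second, so *)
(* that W, which runs over ltpair n, omits no pair of Rset w.               *)
Definition Rset (n : nat) (w : 'S_n) : {set 'I_n * 'I_n} :=
  [set (w ij.2, w ij.1) | ij : 'I_n * 'I_n
                        & (ij.1 < ij.2)%N && (w ij.2 < w ij.1)%N].

Definition W (n : nat) (a : 'I_n -> nat) : coefring n :=
  \sum_(w : 'S_n)
    (\prod_(p : ltpair n | val p \in Rset w) tvar p) *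
    qcst n (\prod_(i < n)
      ((1 - qvar ^+ sigma a i) / (1 - qvar ^+ sigma (a \o w) i))).

(* Main.v *)
Require Import Defs.
From mathcomp Require Import all_boot all_order all_algebra all_fingroup.
From mathcomp Require Import finmap zify ring.
From mathcomp.multinomials Require Import mpoly.

(* Expanding the factors 1 - t_ij x_j / x_i over the sets S of pairs turns
   the product into a sum over tournaments e of t_S times
     D_e = \prod_(i -> j) (x_i / x_j; q)_(a_i) (q x_j / x_i; q)_(a_j - 1).
   The constant term of D_e is read off, by Lagrange interpolation in each
   variable, from the values of D_e on a grid x_i = q ^ al_i with al_i in A_i,
   where #|A_i| - 1 is the order of the pole of D_e at x_i = 0. Such a value
   vanishes unless the intervals [al_i, al_i + a_i[ are pairwise disjoint. The
   sets A_i are built by removing the sinks of e one after the other, so that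
   no disjoint configuration fits when e is not transitive, and exactly one
   (the intervals laid end to end in the order of e) when e is transitive.
   The transitive tournaments are those given by permutations, S being then
   the inversion set, and the value at the single point telescopes. *)

Set Implicit Arguments.
Unset Strict Implicit.
Unset Printing Implicit Defensive.

Import Order.TTheory GRing.Theory Num.Theory.

Local Open Scope ring_scope.

(** * Lagrange interpolation and constant terms in one variable *)

Section Interpolation.
Variable F : fieldType.
Implicit Types (A : seq F) (c : F).

Lemma size_filter_neq (T : eqType) (s : seq T) (c : T) : uniq s -> c \in s ->
  (size [seq b <- s | b != c]).+1 = size s.
Proof.
move=> us cs; rewrite -(count_predC (pred1 c) s) count_uniq_mem // cs.
by rewrite size_filter.
Qed.

Lemma prod_sub_neq0 A c : \prod_(b <- A | b != c) (c - b) != 0.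
Proof.
rewrite prodf_seq_neq0; apply/allP => b _.
by apply/implyP; rewrite subr_eq0 eq_sym.
Qed.

(** As [m < size A], the polynomial ['X^m] equals its Lagrange interpolant [p] at the nodes of [A];
    the two sides are the coefficients of degree [(size A).-1] of [p] and of ['X^m]. *)
Lemma lagrange_coef_sum A m : uniq A -> (m < size A)%N ->
  \sum_(c <- A) c ^+ m / \prod_(b <- A | b != c) (c - b)
    = (m.+1 == size A)%:R.
Proof.
move=> uA mA.
pose l c : {poly F} := \prod_(b <- A | b != c) ('X - b%:P).
pose p : {poly F} :=
  \sum_(c <- A) (c ^+ m / \prod_(b <- A | b != c) (c - b)) *: l c.
have sl c : c \in A -> size (l c) = size A.
  move=> cA; rewrite /l -big_filter size_prod_XsubC.
  exact: size_filter_neq.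
have lE c x : (l c).[x] = \prod_(b <- A | b != c) (x - b).
  by rewrite horner_prod; apply: eq_bigr => b _; rewrite !hornerE.
have sp : (size (p - 'X^m)%R <= size A)%N.
  rewrite (leq_trans (size_polyD _ _)) // geq_max size_polyN size_polyXn mA.
  rewrite andbT /p big_seq; apply: (leq_trans (size_sum _ _ _)).
  by apply/bigmax_leqP_seq => c cA _; rewrite (leq_trans (size_scale_leq _ _)) ?sl.
have p0 : p - 'X^m = 0.
  apply/eqP; apply: contraLR sp => nz; rewrite -ltnNge.
  apply: (max_poly_roots nz _ uA); apply/allP => x xA.
  rewrite /root hornerD hornerN hornerXn /p horner_sum.
  rewrite (bigD1_seq x) //= [X in _ + X - _]big1_seq ?addr0 => [|c /andP[cx cA]].
    by rewrite hornerZ lE mulfVK ?subrr // prod_sub_neq0.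
  rewrite hornerZ lE; apply/eqP; rewrite mulf_eq0; apply/orP; right.
  rewrite prodf_seq_eq0; apply/hasP; exists x => //=.
  by rewrite eq_sym cx subrr eqxx.
have -> : (m.+1 == size A)%:R = ('X^m : {poly F})`_(size A).-1.
  rewrite coefXn; congr (_%:R); case: (size A) mA => // s _.
  by rewrite eqSS eq_sym.
have <- : p = 'X^m by apply/eqP; rewrite -subr_eq0 p0.
rewrite /p coef_sum; apply: eq_big_seq => c cA.
rewrite coefZ -[in _`_ _](sl c cA) -/(lead_coef (l c)).
by have /monicP-> := monic_prod_XsubC A (fun b => b != c) id; rewrite mulr1.
Qed.

(** Pulling [c ^+ (size A).-1] out of the denominator shifts the exponent [z] to
    [m = z + size A - 1], the case of [lagrange_coef_sum]. These weights extract a constant term as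
    long as the exponents are at most 0 and above [- size A]. *)
Lemma lagrange_laurent_sum A (z : int) : uniq A -> 0 \notin A ->
    z <= 0 -> 0 < (size A)%:Z + z ->
  \sum_(c <- A) c ^ z * (\prod_(b <- A | b != c) (1 - b / c))^-1
    = (z == 0)%:R.
Proof.
move=> uA nA0 z0 zA.
have [m mE] : exists m : nat, m.+1%:Z = (size A)%:Z + z.
  by exists (absz ((size A)%:Z + z)).-1; lia.
have mA : (m < size A)%N by lia.
have -> : (z == 0) = (m.+1 == size A) by lia.
rewrite -lagrange_coef_sum //; apply: eq_big_seq => c cA.
have c0 : c != 0 by apply: contraNneq nA0 => <-.
have -> : \prod_(b <- A | b != c) (c - b)
    = c ^+ (size A).-1 * \prod_(b <- A | b != c) (1 - b / c).
  rewrite -(size_filter_neq uA cA) /= -big_filter -[in RHS]big_filter.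
  rewrite -iter_mulr_1 -[size _]count_predT -big_const_seq -big_split /=.
  apply: eq_bigr => b _.
  by rewrite mulrBr mulr1 mulrCA divff // mulr1.
rewrite invfM mulrA; congr (_ * _).
have -> : z = m%:Z - (size A).-1%:Z by lia.
by rewrite expfzDr // exprnN.
Qed.

End Interpolation.

(** * Tournaments, sinks and packed intervals *)

Section Tournament.
Variables (T : finType) (a : T -> nat) (e : rel T).
Hypothesis a_gt0 : forall i, (0 < a i)%N.
Hypothesis e_irr : irreflexive e.
Hypothesis e_tot : forall i j, i != j -> e j i = ~~ e i j.
Implicit Types (X Y : {set T}) (i j k : T) (al : T -> nat).

Definition mass X : nat := \sum_(i in X) a i.
Definition outdeg X i : nat := \sum_(j in X | e i j) 1.
(** Left end of the interval of [i] when intervals of lengths [a] are laid end to end along a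
    transitive [e], [e j i] being an arrow from [j] to [i]. *)
Definition pos X i : nat := \sum_(j in X | e j i) a j.
Definition trans_on X := {in X & &, transitive e}.
Definition sink X k := (k \in X) && [forall j in X, ~~ e k j].
Definition packed X al := {in X &, forall i j, i != j ->
  (al i + a i <= al j)%N || (al j + a j <= al i)%N}.

Lemma sink_beaten X k i : sink X k -> i \in X :\ k -> e i k.
Proof.
case/andP=> kX /forall_inP nk; rewrite !inE => /andP[ik iX].
by rewrite e_tot ?nk // eq_sym.
Qed.

Lemma sinkN X k i : sink X k -> i \in X -> e k i = false.
Proof. by case/andP=> kX /forall_inP nk /nk/negbTE. Qed.

(** A vertex [k] maximising [pos] works: given an arrow from [k] to [j], transitivity makes every
    predecessor of [k] one of [j], so [pos X j] would be at least [pos X k + a k]. *)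
Lemma trans_on_sink X : trans_on X -> X != set0 -> exists k, sink X k.
Proof.
move=> tX /set0Pn[i0 i0X].
case: (@arg_maxnP _ i0 (fun i => i \in X) (pos X) i0X) => k kX km.
exists k; rewrite /sink kX; apply/forall_inP => j jX; apply/negP => ekj.
have := km _ jX; rewrite /= leqNgt => /negP; apply.
rewrite /pos (bigD1 (P := fun l => (l \in X) && e l j) k) ?kX //=.
rewrite -add1n leq_add // [in X in (X <= _)%N]big_mkcond /=.
rewrite [in X in (_ <= X)%N]big_mkcond leq_sum // => l _.
case: ifP => // /andP[lX elk]; rewrite lX (tX k l j) //=.
by rewrite (contraTneq _ elk) // => ->; rewrite e_irr.
Qed.

(** Removing sinks one by one reaches [set0] when [e] is transitive, and otherwise stops at a
    nonempty set without sink, which is the last case. *)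
Lemma sink_ind (P : {set T} -> Prop) : P set0 ->
    (forall X k, sink X k -> P (X :\ k) -> P X) ->
    (forall X, X != set0 -> (forall k, ~~ sink X k) -> P X) ->
  forall X, P X.
Proof.
move=> P0 Ps Pn X; have [m] := ubnP #|X|; elim: m X => // m IH X Xm.
have [->//|X0] := eqVneq X set0.
case: (pickP (sink X)) => [k sk|ns]; last by apply: Pn => // k; rewrite ns.
apply: (Ps _ k) => //; apply: IH; case/andP: sk => kX _.
by move: Xm; rewrite (cardsD1 k) kX.
Qed.

Section SinkStep.
Variables (X : {set T}) (k : T).
Hypothesis sk : sink X k.
Let Y := X :\ k.
Let kX : k \in X. Proof. by case/andP: sk. Qed.

Lemma in_sink i : i \in X -> i != k -> i \in Y.
Proof. by rewrite !inE => -> ->. Qed.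

Lemma sink_in i : i \in Y -> i \in X.
Proof. by rewrite !inE => /andP[]. Qed.

Lemma mass_sink : mass X = (a k + mass Y)%N.
Proof. by rewrite /mass (big_setD1 k). Qed.

Lemma big_sink (R : Type) (idx : R) (op : Monoid.com_law idx)
    (f : T -> T -> R) i : i \in Y ->
  \big[op/idx]_(j in X | e i j) f i j
    = op (f i k) (\big[op/idx]_(j in Y | e i j) f i j).
Proof.
move=> iY; rewrite (bigD1 k) ?kX ?(sink_beaten sk) //=; congr (op _ _).
by apply: eq_bigl => j; rewrite !inE andbC andbA.
Qed.

Lemma big_sink0 (R : Type) (idx : R) (op : Monoid.com_law idx) (f : T -> R) :
  \big[op/idx]_(j in X | e k j) f j = idx.
Proof. by rewrite big1 // => j /andP[jX]; rewrite (sinkN sk). Qed.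

Lemma outdeg_sink i : i \in Y -> outdeg X i = (outdeg Y i).+1.
Proof. by move=> iY; rewrite /outdeg (big_sink _ (fun _ _ => 1%N)). Qed.

Lemma pos_sink : pos X k = mass Y.
Proof.
apply: eq_bigl => j; case: (eqVneq j k) => [->|jk].
  by rewrite e_irr !inE eqxx andbF.
rewrite !inE jk /=; case jX: (j \in X) => //=.
by rewrite (sink_beaten sk) // !inE jk.
Qed.

Lemma pos_sinkN i : i \in Y -> pos X i = pos Y i.
Proof.
move=> iY; apply: eq_bigl => j; rewrite !inE.
by case: eqVneq => // ->; rewrite (sinkN sk (sink_in iY)) andbF.
Qed.

Lemma trans_sink : trans_on X <-> trans_on Y.
Proof.
split=> [tX|tY] j i l.
  by move=> /sink_in jX /sink_in iX /sink_in lX; apply: tX.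
move=> jX iX lX.
have [->|jk] := eqVneq j k; first by rewrite (sinkN sk lX).
have [->|ik] := eqVneq i k; first by rewrite (sinkN sk jX).
have [->|lk] := eqVneq l k; last by apply: tY; apply: in_sink.
by move=> _ _; apply: (sink_beaten sk); apply: in_sink.
Qed.

End SinkStep.

Lemma trans_on0 : trans_on set0.
Proof. by move=> i j k; rewrite inE. Qed.

Lemma sinkless_not_trans X : X != set0 -> (forall k, ~~ sink X k) -> ~ trans_on X.
Proof. by move=> X0 ns /trans_on_sink[] // k; apply/negP. Qed.

Lemma pos_le_mass X i : i \in X -> (pos X i + a i <= mass X)%N.
Proof.
move=> iX; rewrite /mass (bigD1 i) //= addnC leq_add2l.
rewrite /pos !big_mkcondr leq_sum // => j jX.
by case: eqVneq => [->|_] /=; [rewrite e_irr | case: ifP].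
Qed.

(** The right end of each interval is the left end of the next; a sink appends the interval from
    [mass Y] to [mass X]. *)
Lemma prod_pos_telescope (R : comNzRingType) (g : nat -> R) X : trans_on X ->
  (\prod_(i in X) g (pos X i + a i)%N) * g 0%N
    = (\prod_(i in X) g (pos X i)) * g (mass X).
Proof.
elim/sink_ind: X => [|X k sk IH /(trans_sink sk) tY|X X0 ns /sinkless_not_trans[]//].
  by rewrite /mass !big_set0.
have kX : k \in X by case/andP: sk.
have posY i : i \in X :\ k -> pos X i = pos (X :\ k) i by apply: pos_sinkN.
rewrite !(big_setD1 k kX) /= (pos_sink sk) (mass_sink sk) addnC -mulrA.
rewrite (eq_bigr (fun i => g (pos (X :\ k) i + a i)%N)) => [|i /posY->//].
rewrite IH // mulrC; congr (_ * _); rewrite mulrC; congr (_ * _).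
by apply: eq_bigr => i /posY->.
Qed.

(** The intervals tile [[0, mass X[], the sink supplying the last one. *)
Lemma prod_pos_intervals (R : comNzRingType) (h : nat -> R) X : trans_on X ->
  \prod_(i in X) \prod_(t < a i) h (pos X i + t)%N = \prod_(t < mass X) h t.
Proof.
elim/sink_ind: X => [|X k sk IH /(trans_sink sk) tY|X X0 ns /sinkless_not_trans[]//].
  by rewrite /mass !big_set0 big_ord0.
have kX : k \in X by case/andP: sk.
rewrite (big_setD1 k) //= (mass_sink sk) addnC big_split_ord /= mulrC.
congr (_ * _); last by rewrite (pos_sink sk).
by rewrite -IH //; apply: eq_bigr => i iY; rewrite (pos_sinkN sk).
Qed.

(** Take [k] with the largest left end: as [a k > 0], its interval cannot lie before another one. *)
Lemma packed_max X al : X != set0 -> packed X al -> exists k,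
  k \in X /\ {in X :\ k, forall i, (al i + a i <= al k)%N}.
Proof.
move=> /set0Pn[i0 i0X] pX.
case: (@arg_maxnP _ i0 (fun i => i \in X) al i0X) => k kX km.
exists k; split=> // i; rewrite !inE => /andP[ik iX].
by have := pX _ _ iX kX ik; have := km _ iX; have := a_gt0 k; rewrite /=; lia.
Qed.

(** Induction on the number of intervals: the last one is removed and its left end becomes the new
    bound. *)
Lemma packed_mass X al B : packed X al ->
  {in X, forall i, (al i + a i <= B)%N} -> (mass X <= B)%N.
Proof.
have [m] := ubnP #|X|; elim: m X B => // m IH X B Xm pX bX.
have [->|X0] := eqVneq X set0; first by rewrite /mass big_set0.
have [k [kX km]] := packed_max X0 pX.
rewrite /mass (big_setD1 k) //= -/(mass _).
rewrite (leq_trans _ (bX _ kX)) // addnC leq_add2r; apply: IH => //.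
  by move: Xm; rewrite (cardsD1 k) kX.
by move=> i j; rewrite !inE => /andP[_ iX] /andP[_ jX]; apply: pX.
Qed.

Lemma packed_top X al : X != set0 -> packed X al -> exists k,
  [/\ k \in X, {in X :\ k, forall i, (al i + a i <= al k)%N}
    & (mass X <= al k + a k)%N].
Proof.
move=> X0 pX; have [k [kX km]] := packed_max X0 pX.
exists k; split=> //; apply: (packed_mass pX) => i iX.
have [->//|ik] := eqVneq i k.
by rewrite (leq_trans (km i _)) ?leq_addr // !inE ik.
Qed.

Lemma outdeg_le X i : i \in X -> (outdeg X i + a i <= mass X)%N.
Proof.
move=> iX; rewrite /mass (bigD1 i) //= addnC leq_add2l.
rewrite /outdeg !big_mkcondr leq_sum // => j jX.
by case: eqVneq => [->|_]; rewrite ?e_irr //; case: ifP => //= _; apply: a_gt0.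
Qed.

End Tournament.

(** * Grids of powers of q on which few values survive *)

Section Grid.
Variables (T : finType) (a : T -> nat) (e : rel T).
Hypothesis a_gt0 : forall i, (0 < a i)%N.
Hypothesis e_irr : irreflexive e.
Hypothesis e_tot : forall i j, i != j -> e j i = ~~ e i j.
Variables (F : fieldType) (q : F).
Hypothesis q_neq0 : q != 0.
Hypothesis q_nonroot : forall m, (0 < m)%N -> q ^+ m != 1.
Implicit Types (X Y : {set T}) (i j k : T) (al : T -> nat) (A : T -> seq nat).

Lemma qexp_neq0 m : q ^+ m != 0.
Proof. exact: expf_neq0. Qed.

Lemma one_subX_neq0 m : (0 < m)%N -> 1 - q ^+ m != 0.
Proof. by move=> m0; rewrite subr_eq0 eq_sym q_nonroot. Qed.

Lemma qexp_inj : injective (fun m => q ^+ m).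
Proof.
suff le m p : (m <= p)%N -> q ^+ m = q ^+ p -> m = p.
  by move=> m p /= E; have [/le->//|/ltnW/le->] := leqP m p.
rewrite leq_eqVlt => /orP[/eqP//|mp] E.
have /q_nonroot/eqP[] : (0 < p - m)%N by rewrite subn_gt0.
by apply: (mulfI (qexp_neq0 m)); rewrite -exprD subnKC ?mulr1 ?E // ltnW.
Qed.

Lemma qexpB m p : (p <= m)%N -> q ^+ m / q ^+ p = q ^+ (m - p).
Proof. by move=> pm; rewrite -{1}(subnK pm) exprD mulfK ?qexp_neq0. Qed.

Lemma one_sub_div_neq0 m p : m != p -> 1 - q ^+ m / q ^+ p != 0.
Proof.
move=> mp; rewrite subr_eq0 eq_sym; apply: contraNneq mp => E.
by apply/eqP/qexp_inj; rewrite -[LHS](divfK (qexp_neq0 p)) E mul1r.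
Qed.

(** The factor of the arrow [i -> j] evaluated at [x_k = q ^+ al k]. *)
Definition edge al i j : F :=
  qpoch (q ^+ al i / q ^+ al j) q (a i) *
  qpoch (q * (q ^+ al j / q ^+ al i)) q (a j).-1.

Definition edges X al : F := \prod_(i in X) \prod_(j in X | e i j) edge al i j.

(** Lagrange weight of the node [q ^+ m], normalised as in [lagrange_laurent_sum]. *)
Definition node_weight (s : seq nat) (m : nat) : F :=
  (\prod_(b <- s | b != m) (1 - q ^+ b / q ^+ m))^-1.

(** For [s > 0], the q-binomial coefficient of [m + s - 1] over [s - 1]; an interval of length [s]
    starting at [m] will contribute it. *)
Definition qfactor (m s : nat) : F := qpoch (q ^+ m.+1) q s.-1 / qpoch q q s.-1.

(** For an arrow [i -> j], the first symbol of [edge] vanishes when [0 <= al j - al i < a i], the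
    second when [0 < al i - al j < a j]; these are the two ways of overlapping. *)
Lemma edges_packed X al : edges X al != 0 -> packed a X al.
Proof.
move=> nz i j iX jX ij; wlog eij : i j iX jX ij / e i j.
  move=> H; case eij: (e i j); first exact: H.
  by rewrite orbC; apply: H; rewrite // 1?eq_sym // e_tot ?eij.
apply: contraNT nz; rewrite negb_or -!ltnNge => /andP[lt1 lt2].
rewrite /edges (bigD1 i) //= (bigD1 j) ?jX //= -mulrA mulf_eq0; apply/orP; left.
rewrite /edge mulf_eq0; apply/orP.
have [le|lt] := leqP (al i) (al j); [left | right].
  have lti : (al j - al i < a i)%N by lia.
  rewrite /qpoch (bigD1 (Ordinal lti)) //= mulrAC -exprD subnKC //.
  by rewrite divff ?qexp_neq0 // subrr mul0r.
have ltj : (al i - al j - 1 < (a j).-1)%N by lia.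
rewrite /qpoch (bigD1 (Ordinal ltj)) //= mulrA mulrAC -exprS -exprD.
have -> : ((al j).+1 + (al i - al j - 1) = al i)%N by lia.
by rewrite divff ?qexp_neq0 // subrr mul0r.
Qed.

Lemma qpoch_neq0 m s : qpoch (q ^+ m.+1) q s != 0.
Proof.
rewrite prodf_seq_neq0; apply/allP => t _ /=.
by rewrite -exprD one_subX_neq0.
Qed.

Lemma qpoch_split m s : qpoch q q (m + s) = qpoch q q m * qpoch (q ^+ m.+1) q s.
Proof.
rewrite /qpoch big_split_ord /=; congr (_ * _).
by apply: eq_bigr => t _; rewrite -exprS -exprD addSn.
Qed.

(** The left side is what a sink [k] adds to the grid value: the arrows into [k], the new nodes of
    the other vertices and the weight of [k]. By tiling, the first symbols cancel the weight of [k]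
    ([P1]); the second ones and the new nodes give quotients of [g] at the two ends of each interval
    ([P2]), which telescope to [g 0 / g M]. *)
Lemma sink_step_value Y k al : trans_on e Y -> {in Y, al =1 pos a e Y} ->
    al k = mass a Y ->
  (\prod_(i in Y) edge al i k) *
  (\prod_(i in Y)
     (\prod_(b <- iota (mass a Y - a i).+1 (a k).-1)
        (1 - q ^+ b / q ^+ al i))^-1) *
  (\prod_(t < mass a Y) (1 - q ^+ t / q ^+ al k))^-1
  = qfactor (al k) (a k).
Proof.
move=> tY alY alk; set M := mass a Y.
have le i : i \in Y -> (al i + a i <= M)%N.
  by move=> iY; rewrite alY // pos_le_mass.
pose g s := qpoch (q ^+ (M - s).+1) q (a k).-1.
have g0 s : g s != 0 by exact: qpoch_neq0.
have P1 : \prod_(i in Y) qpoch (q ^+ al i / q ^+ al k) q (a i)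
    = \prod_(t < M) (1 - q ^+ t / q ^+ al k).
  rewrite -(prod_pos_intervals a_gt0 e_irr e_tot (fun t => 1 - q ^+ t / q ^+ al k) tY).
  apply: eq_bigr => i iY; apply: eq_bigr => t _.
  by rewrite mulrAC -exprD alY.
have P2 i : i \in Y ->
    qpoch (q * (q ^+ al k / q ^+ al i)) q (a k).-1 *
    (\prod_(b <- iota (M - a i).+1 (a k).-1) (1 - q ^+ b / q ^+ al i))^-1
    = g (pos a e Y i) / g (pos a e Y i + a i)%N.
  move=> iY; have lei := le i iY; rewrite -alY //; congr (_ / _).
    by rewrite /g alk qexpB -/M -?exprS //; lia.
  rewrite -[in LHS](addn0 (M - a i).+1) iotaDl big_map -/M.
  have -> : iota 0 (a k).-1 = index_iota 0 (a k).-1 by rewrite /index_iota subn0.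
  rewrite big_mkord; apply: eq_bigr => t _.
  by rewrite qexpB -?exprD; [congr (_ - q ^+ _); lia | lia].
rewrite big_split /= P1.
have cancel (x y z : F) : x != 0 -> x * y * z / x = y * z by move=> x0; field.
rewrite cancel; last first.
  rewrite prodf_seq_neq0; apply/allP => t _ /=.
  by rewrite one_sub_div_neq0 // alk -/M; have := ltn_ord t; lia.
rewrite -big_split /= (eq_bigr _ P2) big_split /= prodfV.
have := prod_pos_telescope a_gt0 e_irr e_tot g tY; rewrite -/M => tel.
have n0 : \prod_(i in Y) g (pos a e Y i + a i)%N != 0.
  by apply/prodf_neq0.
apply: (mulIf n0); rewrite divfK //; apply: (mulIf (g0 M)).
rewrite -tel /qfactor alk -/M /g subn0 subnn expr1 mulrC [in RHS]mulrAC divfK //.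
by have := qpoch_neq0 0 (a k).-1.
Qed.

Definition grid_value A X al : F :=
  edges X al * \prod_(i in X) node_weight (A i) (al i).

(** Built along [sink_ind]. For [X = setT], the size condition makes [size (A i)] exceed by one the
    pole order at [x_i = 0]; the bound keeps all intervals inside [[0, mass X]], so a packed
    configuration fills that range and its last interval ends at [mass X]. *)
Lemma grid_exists X : exists A,
  [/\ {in X, forall i, uniq (A i)},
      {in X, forall i, size (A i) + outdeg e X i + a i = (mass a X).+1}%N,
      {in X, forall i b, b \in A i -> (b + a i <= mass a X)%N},
      forall al, packed a X al -> {in X, forall i, al i \in A i} ->
        trans_on e X /\ {in X, al =1 pos a e X}
    & trans_on e X -> {in X, forall i, pos a e X i \in A i} /\
        grid_value A X (pos a e X) = \prod_(i in X) qfactor (pos a e X i) (a i)].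
Proof.
elim/(sink_ind (e := e)): X => [|X k sk [A [uA sA bA pA vA]]|X X0 ns].
- exists (fun=> [::]); split=> [i|i|i|al _ _|_]; rewrite ?inE //.
    by split=> [|i]; [apply: trans_on0 | rewrite inE].
  by split=> [i|]; rewrite ?inE // /grid_value /edges !big_set0 mulr1.
- pose Y := X :\ k; have kX : k \in X by case/andP: sk.
  have mX : mass a X = (a k + mass a Y)%N by apply: mass_sink sk.
  have mY i : i \in Y -> (a i <= mass a Y)%N.
    by move=> iY; rewrite (leq_trans _ (pos_le_mass a e_irr iY)) ?leq_addl.
  (* The new nodes of i stop one short of mass X - a i, so that in a packed
     configuration only k can be last. *)
  pose A' i := if i == k then iota 0 (mass a Y).+1
    else A i ++ iota (mass a Y - a i).+1 (a k).-1.
  have A'k : A' k = iota 0 (mass a Y).+1 by rewrite /A' eqxx.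
  have A'Y i : i \in Y -> A' i = A i ++ iota (mass a Y - a i).+1 (a k).-1.
    by rewrite !inE /A' => /andP[/negbTE->].
  have XY i : i \in X -> i = k \/ i \in Y.
    by rewrite !inE; case: eqVneq => [->|_]; [left | right].
  have ak := a_gt0 k.
  exists A'; split.
  + move=> i /XY[->|iY]; first by rewrite A'k iota_uniq.
    rewrite A'Y // cat_uniq uA // iota_uniq andbT /=.
    apply/hasPn => b; rewrite mem_iota => /andP[lb _].
    apply/negP => /(bA _ iY); have := mY i iY; rewrite -/Y; lia.
  + move=> i /XY[->|iY]; first by rewrite A'k size_iota /outdeg (big_sink0 sk); lia.
    have := sA i iY; rewrite A'Y // size_cat size_iota (outdeg_sink e_tot sk iY).
    by rewrite -/Y; lia.
  + move=> i /XY[->|iY] b; first by rewrite A'k mem_iota; lia.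
    rewrite A'Y // mem_cat mem_iota; have := mY i iY.
    by move=> + /orP[/(bA _ iY)|]; rewrite -/Y; lia.
  + move=> al pal alA.
    have X0 : X != set0 by apply/set0Pn; exists k.
    have [m [mX' top mm]] := packed_top a_gt0 X0 pal.
    have mk : m = k.
      case: (XY _ mX') => // mY'; have := alA m mX'; rewrite A'Y // mem_cat mem_iota.
      have := mY m mY'.
      by move=> + /orP[/(bA _ mY')|]; rewrite -/Y; lia.
    subst m; have alk : al k = mass a Y.
      by have := alA k kX; rewrite A'k mem_iota; lia.
    (* The other intervals end by [al k = mass Y], which excludes the added nodes: the configuration
       restricts to the grid of [Y]. *)
    have [|i iY|tY alY] := pA al.
    * by move=> i j /(@sink_in _ X k) iX /(@sink_in _ X k) jX; apply: pal.
    * have := alA i (sink_in iY); rewrite A'Y // mem_cat mem_iota => /orP[//|].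
      by have := top i iY; have := mY i iY; rewrite -/Y alk; lia.
    split; first exact/(trans_sink e_tot sk).
    move=> i /XY[->|iY]; first by rewrite (pos_sink a e_irr e_tot sk) alk.
    by rewrite (pos_sinkN a sk iY) alY.
  + move=> /(trans_sink e_tot sk) tY; have [pY vY] := vA tY.
    have posk := pos_sink a e_irr e_tot sk.
    have posY i : i \in Y -> pos a e X i = pos a e Y i by apply: pos_sinkN.
    split=> [i /XY[->|iY]|].
    * by rewrite A'k posk mem_iota ltnSn.
    * by rewrite A'Y // posY // mem_cat pY.
    have step := sink_step_value tY posY posk.
    rewrite (big_setD1 k kX) /= -step (eq_bigr (fun i => qfactor (pos a e Y i) (a i))).
      rewrite -/Y -vY /grid_value.
      have eX : edges X (pos a e X)
          = (\prod_(i in Y) edge (pos a e X) i k) * edges Y (pos a e Y).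
        rewrite /edges (big_setD1 k kX) /= (big_sink0 sk) mul1r -big_split /=.
        apply: eq_bigr => i iY; rewrite (big_sink e_tot sk) //=; congr (_ * _).
        by apply: eq_bigr => j /andP[jY _]; rewrite /edge !posY.
      have wk : node_weight (A' k) (pos a e X k)
          = (\prod_(t < mass a Y) (1 - q ^+ t / q ^+ pos a e X k))^-1.
        rewrite /node_weight A'k -addn1 iotaD big_cat /= big_cons posk eqxx big_nil /=.
        congr (_^-1); rewrite mulr1 -(big_mkord xpredT (fun t => 1 - q ^+ t / _)).
        rewrite /index_iota subn0 big_seq_cond [RHS]big_seq_cond.
        by apply: eq_bigl => t; rewrite mem_iota -/Y; lia.
      have wY i : i \in Y -> node_weight (A' i) (pos a e X i)
          = node_weight (A i) (pos a e Y i) *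
            (\prod_(b <- iota (mass a Y - a i).+1 (a k).-1)
               (1 - q ^+ b / q ^+ pos a e X i))^-1.
        move=> iY; rewrite /node_weight A'Y // big_cat invfM posY //=.
        congr (_ * _^-1); rewrite big_seq_cond [RHS]big_seq_cond.
        apply: eq_bigl => t; rewrite mem_iota.
        by have := pos_le_mass a e_irr iY; rewrite -/Y; lia.
      rewrite (big_setD1 k kX) /= wk (eq_bigr _ wY) big_split /= eX.
      by rewrite -!mulrA; congr (_ * _); rewrite mulrCA [in RHS]mulrCA; ring.
    by move=> i iY; rewrite posY.
(* Without sink, each vertex has positive outdegree, so its nodes stop short of [mass a X - a i] and
   no interval can be the last one. *)
- have sX i : i \in X -> (outdeg e X i + a i <= mass a X)%N by apply: outdeg_le.
  exists (fun i => iota 0 (mass a X - a i - outdeg e X i).+1).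
  split=> [i iX|i iX|i iX b|al pal alX|/(sinkless_not_trans a_gt0 e_irr X0 ns)//].
  + exact: iota_uniq.
  + by rewrite size_iota; have := sX i iX; lia.
  + by rewrite mem_iota; have := sX i iX; lia.
  have [m [mX top mm]] := packed_top a_gt0 X0 pal.
  have : (0 < outdeg e X m)%N.
    have := ns m; rewrite /sink mX /= negb_forall_in => /exists_inP[j jX].
    by rewrite negbK => emj; rewrite /outdeg (bigD1 j) ?jX.
  by have := alX m mX; rewrite mem_iota; have := sX m mX; lia.
Qed.

End Grid.

(** * Evaluation of Laurent polynomials at characters *)

Section Evaluation.
Variables (n : nat) (R : comNzRingType) (chi : 'rV[int]_n -> R).
Hypothesis chi0 : chi 0 = 1.
Hypothesis chiD : forall u v, chi (u + v) = chi u * chi v.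
Implicit Types f g : laurent n R.

(** A point with invertible coordinates is represented by the character [chi] of the exponent group
    that it defines. *)
Definition leval f : R := \sum_(u <- lsupp f) lcoef u f * chi u.

Lemma levalw (d : {fset 'rV[int]_n}) f : (lsupp f `<=` d)%fset ->
  leval f = \sum_(u <- d) lcoef u f * chi u.
Proof.
move=> fd; rewrite /leval (big_fset_incl _ fd) // => u _.
by rewrite lsuppE negbK => /eqP->; rewrite mul0r.
Qed.

Lemma leval_term c u : leval (lterm c u) = c * chi u.
Proof.
by rewrite (levalw (lsupp_term c u)) big_seq_fset1 lcoef_term eqxx.
Qed.

Lemma levalD : {morph leval : f g / f + g}.
Proof.
move=> f g; rewrite (levalw (lsuppD f g)).
rewrite (levalw (fsubsetUl (lsupp f) (lsupp g))).
rewrite (levalw (fsubsetUr (lsupp f) (lsupp g))) -big_split.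
by apply: eq_bigr => u _; rewrite raddfD mulrDl.
Qed.

Lemma leval0 : leval 0 = 0.
Proof. by rewrite -(lterm0 R (0 : 'rV_n)) leval_term mul0r. Qed.

Lemma leval1 : leval 1 = 1.
Proof. by rewrite [1 in LHS]/(lterm 1 0) leval_term chi0 mulr1. Qed.

Lemma leval_sum (I : Type) (r : seq I) (h : I -> laurent n R) :
  leval (\sum_(i <- r) h i) = \sum_(i <- r) leval (h i).
Proof. exact: (big_morph leval levalD leval0). Qed.

Lemma levalM : {morph leval : f g / f * g}.
Proof.
move=> f g; rewrite [f * g]lmulE leval_sum [in RHS]/leval mulr_suml.
apply: eq_bigr => u _; rewrite leval_sum mulr_sumr; apply: eq_bigr => v _.
by rewrite leval_term chiD mulrACA.
Qed.

Lemma leval_prod (I : Type) (r : seq I) (P : pred I) (h : I -> laurent n R) :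
  leval (\prod_(i <- r | P i) h i) = \prod_(i <- r | P i) leval (h i).
Proof. exact: (big_morph leval levalM leval1). Qed.

End Evaluation.

(** * Homogeneity and pole orders *)

Section Cone.
Variables (n : nat) (R : comNzRingType).
Implicit Types (f g : laurent n R) (d : 'I_n -> nat).

(** Total degree 0 is recorded with the pole orders because it gives every nonconstant monomial a
    negative exponent, which interpolation detects. *)
Definition cone d f := forall u, lcoef u f != 0 ->
  \sum_i u 0 i = 0 /\ forall i, 0 <= u 0 i + (d i)%:Z.

Lemma coneM d d' f g : cone d f -> cone d' g ->
  cone (fun k => d k + d' k)%N (f * g).
Proof.
move=> cf cg u nz.
have /hasP[v vf /hasP[w wg /eqP<-]] :
    has (fun v => has (fun w => v + w == u) (lsupp g)) (lsupp f).
  apply: contraNT nz => /hasPn no; rewrite [f * g]lmulE raddf_sum big1_seq //=.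
  move=> v /= /no/hasPn nov; rewrite raddf_sum big1_seq //= => w /= /nov.
  by rewrite lcoef_term => /negbTE->.
move: vf wg; rewrite !lsuppE => /cf[sv v0] /cg[sw w0]; split.
  by under eq_bigr do rewrite mxE; rewrite big_split /= sv sw.
move=> i; rewrite mxE; have := v0 i; have := w0 i.
rewrite PoszD; move: (v 0 i) (w 0 i) => s t; lia.
Qed.

Lemma cone1 : cone (fun=> 0%N) 1.
Proof.
move=> u; rewrite lcoef_term; have [<- _|_] := eqVneq 0 u; last by rewrite eqxx.
by split=> [|i]; [rewrite big1 // => i _ |]; rewrite mxE.
Qed.

Lemma cone_prod (I : Type) (r : seq I) (P : pred I) (d : I -> 'I_n -> nat)
    (h : I -> laurent n R) : (forall i, P i -> cone (d i) (h i)) ->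
  cone (fun k => \sum_(i <- r | P i) d i k)%N (\prod_(i <- r | P i) h i).
Proof.
move=> ch; elim: r => [|i r IH].
  by rewrite big_nil => u /cone1[-> u0]; split=> // k; rewrite big_nil.
rewrite big_cons; case: ifP => Pi u.
  by move=> /(coneM (ch i Pi) IH)[-> u0]; split=> // k; rewrite big_cons Pi.
by move=> /IH[-> u0]; split=> // k; rewrite big_cons Pi.
Qed.

Lemma sum_delta (i : 'I_n) : \sum_k (delta_mx 0 i : 'rV[int]_n) 0 k = 1.
Proof.
rewrite (bigD1 i) //= big1 => [|k ki]; rewrite mxE ?eqxx ?addr0 //.
by rewrite (negbTE ki).
Qed.

Lemma cone_factor (c : R) (i j : 'I_n) :
  cone (fun k => (k == j) : nat) (1 - c *: xratio R i j).
Proof.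
move=> u; rewrite raddfB /= [lcoef u (c *: _)]lcoef_is_scalable !lcoef_term.
have [<- _|_] := eqVneq 0 u.
  by split=> [|k]; rewrite ?big1 // => *; rewrite mxE.
have [<- _|_] := eqVneq (_ - _) u; last by rewrite mulr0 subr0 eqxx.
split=> [|k].
  under eq_bigr do rewrite mxE [X in _ + X]mxE.
  by rewrite big_split /= sumrN !sum_delta subrr.
by rewrite !mxE !eqxx /=; case: (k == i); case: (k == j).
Qed.

End Cone.

(** * Constant terms by interpolation on a grid *)

Section CharacterSum.
Variables (n : nat) (F : fieldType) (q : F).
Hypothesis q_neq0 : q != 0.
Hypothesis q_nonroot : forall m, (0 < m)%N -> q ^+ m != 1.
Variables (A : 'I_n -> seq nat) (N : nat).
Hypothesis uniqA : forall i, uniq (A i).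
Hypothesis boundA : forall i b, b \in A i -> (b < N)%N.

(** Grid points are finite functions into ['I_N], so that a sum over them can be factored; this
    leads back to the lists [A i]. *)
Lemma sum_ord_mem (h : nat -> F) (i : 'I_n) :
  \sum_(b : 'I_N | val b \in A i) h b = \sum_(b <- A i) h b.
Proof.
rewrite -(big_map val (fun b => b \in A i) h) /= -big_filter.
apply: perm_big; apply: uniq_perm; rewrite ?uniqA //.
  by rewrite filter_uniq // map_inj_uniq ?index_enum_uniq //; apply: val_inj.
move=> b; rewrite mem_filter; case bA: (b \in A i) => //=.
by apply/mapP; exists (Ordinal (boundA bA)); rewrite ?mem_index_enum.
Qed.

(** The sum factors over the variables. For [u = 0] each factor is 1; otherwise some exponent is
    negative, the sum being 0, and its factor vanishes by [lagrange_laurent_sum]. *)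
Lemma grid_character_sum (u : 'rV[int]_n) :
    \sum_i u 0 i = 0 -> (forall i, 0 < u 0 i + (size (A i))%:Z) ->
  \sum_(al : {ffun 'I_n -> 'I_N} |
        al \in family (fun i (b : 'I_N) => val b \in A i))
    \prod_i (node_weight q (A i) (al i) * (q ^+ al i) ^ u 0 i) = (u == 0)%:R.
Proof.
move=> su du; rewrite -(bigA_distr_big_dep (fun i (b : 'I_N) => val b \in A i)
  (fun i b => node_weight q (A i) b * (q ^+ b) ^ u 0 i)).
have factor i : u 0 i <= 0 ->
    \sum_(b : 'I_N | val b \in A i) node_weight q (A i) b * (q ^+ b) ^ u 0 i
    = (u 0 i == 0)%:R.
  move=> ui; rewrite (sum_ord_mem (fun b => node_weight q (A i) b * (q ^+ b) ^ u 0 i)).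
  have qinj := qexp_inj q_neq0 q_nonroot.
  rewrite -(@lagrange_laurent_sum _ [seq q ^+ b | b <- A i]) //.
  - rewrite big_map; apply: eq_bigr => b _; rewrite mulrC; congr (_ * _^-1).
    by rewrite big_map; apply: eq_bigl => c; rewrite (inj_eq qinj).
  - by rewrite map_inj_uniq.
  - by apply/mapP => -[b _ /esym/eqP]; rewrite (negbTE (qexp_neq0 q_neq0 b)).
  - by rewrite size_map addrC.
have [uE|u0] := eqVneq u 0.
  by rewrite big1 // => i _; rewrite factor uE mxE.
have [i ui|ge0] := pickP (fun i => u 0 i < 0).
  by rewrite (bigD1 i) //= factor ?ltW // lt_eqF // mul0r.
case/eqP: u0; apply/rowP => i; rewrite mxE; apply/eqP.
have : \sum_i u 0 i == 0 by rewrite su.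
rewrite psumr_eq0 => [/allP/(_ i)|j _]; last by rewrite leNgt ge0.
by rewrite mem_index_enum; apply.
Qed.

Variables (R : comNzRingType) (phi : {rmorphism F -> R}).

(** Weights and powers of [q] need inverses and live in [F]; [phi] carries them to the coefficient
    ring [R]. *)
Definition grid_char (al : 'I_n -> nat) (u : 'rV[int]_n) : R :=
  phi (\prod_i (q ^+ al i) ^ u 0 i).

Lemma grid_char0 al : grid_char al 0 = 1.
Proof. by rewrite /grid_char big1 ?rmorph1 // => i _; rewrite mxE. Qed.

Lemma grid_charD al u v : grid_char al (u + v) = grid_char al u * grid_char al v.
Proof.
rewrite /grid_char -rmorphM -big_split /=; congr (phi _); apply: eq_bigr => i _.
by rewrite mxE expfzDr // qexp_neq0.
Qed.

(** By linearity it is enough to treat each monomial of [f], where the right side is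
    [grid_character_sum]. *)
Lemma CT_interpolation (d : 'I_n -> nat) (f : laurent n R) :
    (forall i, (d i < size (A i))%N) -> cone d f ->
  CT f = \sum_(al : {ffun 'I_n -> 'I_N} |
             al \in family (fun i (b : 'I_N) => val b \in A i))
           phi (\prod_i node_weight q (A i) (al i)) *
           leval (grid_char (fun i => al i)) f.
Proof.
move=> dA cf; rewrite /leval; under [RHS]eq_bigr do rewrite mulr_sumr.
rewrite exchange_big /CT {1}[f](laurentE (fsubset_refl _)) raddf_sum /=.
apply: eq_big_seq => u; rewrite lsuppE => /cf[su du].
under eq_bigr do rewrite mulrCA -rmorphM -big_split /=.
rewrite -mulr_sumr -rmorph_sum grid_character_sum // => [|i].
  by rewrite lcoef_term rmorph_nat mulr_natr.
by rewrite (le_lt_trans (du i)) // ltrD2l ltz_nat.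
Qed.

End CharacterSum.

(** * Constant term of a tournament product *)

Section TournamentCT.
Variables (n : nat) (F : fieldType) (q : F).
Hypothesis q_neq0 : q != 0.
Hypothesis q_nonroot : forall m, (0 < m)%N -> q ^+ m != 1.
Variables (R : comNzRingType) (phi : {rmorphism F -> R}).
Variable a : 'I_n -> nat.
Hypothesis a_gt0 : forall i, (0 < a i)%N.

Let Q : laurent n R := (phi q)%:A.

Definition lfactor (i j : 'I_n) : laurent n R :=
  qpoch (xratio R i j) Q (a i) * qpoch (Q * xratio R j i) Q (a j).-1.

Lemma mul_scalarX (f : laurent n R) t : f * Q ^+ t = phi (q ^+ t) *: f.
Proof. by rewrite exprZn expr1n -scalerAr mulr1 rmorphXn. Qed.

Lemma qpoch_xratio i j m :
  qpoch (xratio R i j) Q m = \prod_(t < m) (1 - phi (q ^+ t) *: xratio R i j).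
Proof. by apply: eq_bigr => t _; rewrite mul_scalarX. Qed.

Lemma qpoch_qxratio i j m :
  qpoch (Q * xratio R i j) Q m
    = \prod_(t < m) (1 - phi (q ^+ t.+1) *: xratio R i j).
Proof.
by apply: eq_bigr => t _; rewrite mulrAC -exprS mulrC mul_scalarX.
Qed.

Lemma grid_char_ratio (al : 'I_n -> nat) i j :
  grid_char q phi al (delta_mx 0 i - delta_mx 0 j)
    = phi (q ^+ al i / q ^+ al j).
Proof.
rewrite grid_charD // /grid_char -rmorphM; congr (phi (_ * _)).
  rewrite (bigD1 i) //= big1 => [|k ki]; first by rewrite mxE !eqxx mulr1.
  by rewrite mxE (negbTE ki) andbF.
rewrite (bigD1 j) //= big1 => [|k kj]; first by rewrite !mxE !eqxx mulr1.
by rewrite !mxE (negbTE kj) andbF.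
Qed.

Lemma leval_factor (al : 'I_n -> nat) (c : F) i j :
  leval (grid_char q phi al) (1 - phi c *: xratio R i j)
    = phi (1 - c * (q ^+ al i / q ^+ al j)).
Proof.
rewrite levalD leval1 ?grid_char0 // -scaleNr lscale_term mulr1 leval_term.
by rewrite grid_char_ratio -rmorphN -rmorphM rmorphD rmorph1 mulNr.
Qed.

Lemma leval_lfactor (al : 'I_n -> nat) i j :
  leval (grid_char q phi al) (lfactor i j) = phi (edge a q al i j).
Proof.
have c0 := grid_char0 q phi al; have cD := grid_charD q_neq0 phi al.
rewrite levalM // qpoch_xratio qpoch_qxratio !leval_prod // rmorphM !rmorph_prod.
by congr (_ * _); apply: eq_bigr => t _; rewrite leval_factor; congr (phi _);
  rewrite ?exprS; ring.
Qed.

Lemma cone_lfactor i j :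
  cone (fun k => a i * (k == j) + (a j).-1 * (k == i))%N (lfactor i j).
Proof.
rewrite /lfactor qpoch_xratio qpoch_qxratio => u.
move=> /(coneM (cone_prod (fun t _ => @cone_factor n R _ i j))
               (cone_prod (fun t _ => @cone_factor n R _ j i)))[su du].
by split=> // k; have := du k; rewrite !sum_nat_const !card_ord.
Qed.

Variable e : rel 'I_n.
Hypothesis e_irr : irreflexive e.
Hypothesis e_tot : forall i j, i != j -> e j i = ~~ e i j.

Definition ltournament : laurent n R := \prod_i \prod_(j | e i j) lfactor i j.

(** The pole at [x_k = 0] has order at most the sum of [a i] over arrows [i -> k] and of [a j - 1]
    over arrows [k -> j], that is [mass - a k - outdeg k], one less than [s k]. *)
Lemma cone_ltournament (s : 'I_n -> nat) :
    (forall i, s i + outdeg e setT i + a i = (mass a setT).+1)%N ->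
  exists2 d : 'I_n -> nat, (forall i, d i < s i)%N & cone d ltournament.
Proof.
move=> sE.
exists (fun k => \sum_i \sum_(j | e i j) (a i * (k == j) + (a j).-1 * (k == i)))%N.
  move=> k; have := sE k.
  have -> : (\sum_i \sum_(j | e i j) (a i * (k == j) + (a j).-1 * (k == i))
      = \sum_(i | e i k) a i + \sum_(j | e k j) (a j).-1)%N.
    under eq_bigr do rewrite big_split /=; rewrite big_split /=; congr (_ + _)%N.
      rewrite [RHS]big_mkcond; apply: eq_bigr => i _; rewrite big_mkcond.
      rewrite (bigD1 k) //= big1 => [|j jk]; first by rewrite eqxx muln1 addn0.
      by rewrite eq_sym (negbTE jk) muln0 if_same.
    rewrite (bigD1 k) //= [X in (_ + X)%N]big1 => [|i ik].
      by rewrite addn0; apply: eq_bigr => j _; rewrite eqxx muln1.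
    by rewrite big1 // => j _; rewrite eq_sym (negbTE ik) muln0.
  have -> : mass a setT = (a k + \sum_(i | e i k) a i + \sum_(j | e k j) a j)%N.
    rewrite /mass (bigD1 k) ?inE //= -addnA; congr (_ + _)%N.
    rewrite (bigID (fun i => e i k)) /=; congr (_ + _)%N; apply: eq_bigl => i.
      by rewrite inE; case: eqVneq => //= ->; rewrite e_irr.
    by rewrite inE; case: eqVneq => [->|ik] /=; rewrite ?e_irr // (e_tot ik).
  have -> : (\sum_(j | e k j) a j = \sum_(j | e k j) (a j).-1 + outdeg e setT k)%N.
    have -> : outdeg e setT k = (\sum_(j | e k j) 1)%N.
      by apply: eq_bigl => j; rewrite inE.
    by rewrite -big_split; apply: eq_bigr => j _; rewrite /= addn1 prednK.
  by lia.
apply: cone_prod => i _; apply: cone_prod => j _; exact: cone_lfactor.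
Qed.

(** Only packed grid points contribute. [grid_exists] leaves none when [e] is not transitive, and
    otherwise only [pos], whose contribution it evaluates. *)
Lemma CT_ltournament :
  (trans_on e setT ->
     CT ltournament = phi (\prod_i qfactor q (pos a e setT i) (a i))) /\
  (~ trans_on e setT -> CT ltournament = 0).
Proof.
have [A [uA sA bA pA vA]] := grid_exists a_gt0 e_irr e_tot q_neq0 q_nonroot setT.
pose N := (mass a setT).+1.
have {}uA i : uniq (A i) by apply: uA; rewrite inE.
have {}bA i b : b \in A i -> (b < N)%N.
  by move=> /(bA i (in_setT i)); rewrite ltnS; apply: leq_trans; rewrite leq_addr.
have [d dA cD] := cone_ltournament (fun i => sA i (in_setT i)).
rewrite (CT_interpolation q_neq0 q_nonroot uA bA phi dA cD).
have ev al : leval (grid_char q phi al) ltournament = phi (edges a e q setT al).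
  rewrite leval_prod ?grid_char0 //; last exact: grid_charD.
  rewrite rmorph_prod /= [RHS](eq_bigl xpredT) => [|i]; last by rewrite inE.
  apply: eq_bigr => i _; rewrite leval_prod ?grid_char0 //; last exact: grid_charD.
  rewrite rmorph_prod; apply: eq_big => [j|j _]; first by rewrite inE.
  exact: leval_lfactor.
have supp (al : {ffun 'I_n -> 'I_N}) :
    al \in family (fun i (b : 'I_N) => val b \in A i) ->
    edges a e q setT (fun i => al i) != 0 ->
    trans_on e setT /\ forall i, al i = pos a e setT i :> nat.
  move=> /familyP alA /(edges_packed e_tot q_neq0) pal.
  have [|tX alE] := pA _ pal; first by move=> i _; apply: alA.
  by split=> // i; apply: alE; rewrite inE.
split=> [tX|ntX]; last first.
  rewrite big1 // => al alA; rewrite ev.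
  have [->|/(supp al alA)[]//] := eqVneq (edges a e q setT (fun i => al i)) 0.
  by rewrite rmorph0 mulr0.
have [posA val] := vA tX.
have ltN i : (pos a e setT i < N)%N by apply: (bA i); apply: posA; rewrite inE.
pose al0 : {ffun 'I_n -> 'I_N} := [ffun i => Ordinal (ltN i)].
have al0E i : al0 i = pos a e setT i :> nat by rewrite ffunE.
rewrite (bigD1 al0) /=; last first.
  by apply/familyP => i; rewrite unfold_in ffunE; apply: posA; rewrite inE.
rewrite [X in _ + X]big1 => [|al /andP[alA ne]].
  rewrite addr0 ev -rmorphM mulrC; congr (phi _).
  rewrite [RHS](eq_bigl (fun i => i \in setT)) => [|i]; last by rewrite inE.
  rewrite -val /grid_value; congr (_ * _).
    by apply: eq_bigr => i _; apply: eq_bigr => j _; rewrite /edge !al0E.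
  by apply: eq_big => [i|i _]; rewrite ?inE ?al0E.
rewrite ev.
have [->|/(supp al alA)[_ alE]] := eqVneq (edges a e q setT (fun i => al i)) 0.
  by rewrite rmorph0 mulr0.
by case/eqP: ne; apply/ffunP => i; apply: val_inj; rewrite /= alE al0E.
Qed.

End TournamentCT.

Lemma qpochS (R : comNzRingType) (x q : R) m :
  qpoch x q m.+1 = (1 - x) * qpoch (q * x) q m.
Proof.
rewrite /qpoch big_ord_recl expr0 mulr1; congr (_ * _).
by apply: eq_bigr => t _; rewrite mulrAC -exprS mulrC.
Qed.

(** * Linear orders given by permutations *)

Section PermutationOrder.
Variables (n : nat) (a : 'I_n -> nat) (w : 'S_n).
Hypothesis a_gt0 : forall i, (0 < a i)%N.

(** The values of [w] list the vertices in this order, so the rank of [i] is its preimage. *)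
Definition perm_order : rel 'I_n := fun i j => ((w^-1)%g i < (w^-1)%g j)%N.

Lemma perm_order_irr : irreflexive perm_order.
Proof. by move=> i; rewrite /perm_order ltnn. Qed.

Lemma perm_order_tot i j : i != j -> perm_order j i = ~~ perm_order i j.
Proof.
move=> ij; rewrite /perm_order -leqNgt ltn_neqAle.
by rewrite (inj_eq (@ord_inj n)) (inj_eq perm_inj) eq_sym (negbTE ij).
Qed.

Lemma perm_order_trans : trans_on perm_order setT.
Proof. by move=> j i k _ _ _; apply: ltn_trans. Qed.

Lemma sigma_perm i :
  sigma (a \o w) i = (pos a perm_order setT (w i) + a (w i))%N.
Proof.
rewrite /sigma (bigD1 i) //= addnC; congr (_ + _)%N.
rewrite /pos [RHS](reindex_inj (@perm_inj _ w)) /=; apply: eq_bigl => k.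
by rewrite inE /perm_order !permK ltn_neqAle andbC.
Qed.

Variables (F : fieldType) (q : F).
Hypothesis q_neq0 : q != 0.
Hypothesis q_nonroot : forall m, (0 < m)%N -> q ^+ m != 1.

Lemma qbinom_qfactor m s : (0 < s)%N ->
  qbinom q (m + s).-1 s.-1 = qfactor q m s.
Proof.
case: s => // s _; rewrite addnS /= /qbinom leq_addl addnK qpoch_split /qfactor /=.
rewrite [qpoch q q s * _]mulrC -mulf_div divff ?mul1r //.
by have := qpoch_neq0 q_nonroot 0 m.
Qed.

(** The factor [1 - q ^+ (pos + a)] completes the numerator of [qfactor] to [a] consecutive
    exponents, and by tiling these run once through [1, ..., mass]. The result is the same for all
    [w]. *)
Lemma prod_one_sub_qfactor :
  (\prod_i (1 - q ^+ sigma (a \o w) i)) *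
  \prod_i qfactor q (pos a perm_order setT i) (a i)
  = qpoch q q (mass a setT) / \prod_i qpoch q q (a i).-1.
Proof.
have -> : \prod_i (1 - q ^+ sigma (a \o w) i)
    = \prod_i (1 - q ^+ (pos a perm_order setT i + a i)).
  rewrite [RHS](reindex_inj (@perm_inj _ w)).
  by apply: eq_bigr => i _; rewrite sigma_perm.
rewrite big_split /= prodfV mulrA; congr (_ / _); rewrite -big_split /=.
transitivity (\prod_(t < mass a setT) (1 - q ^+ t.+1)); last first.
  by apply: eq_bigr => t _; rewrite exprS.
rewrite -(prod_pos_intervals a_gt0 perm_order_irr perm_order_tot
  (fun t => 1 - q ^+ t.+1) perm_order_trans).
apply: eq_big => [i|i _]; first by rewrite inE.
case: (a i) (a_gt0 i) => // s _.
rewrite big_ord_recr /= mulrC addnS; congr (_ * _).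
by apply: eq_bigr => t _; rewrite -exprD addSn.
Qed.

End PermutationOrder.

(** [prod_one_sub_qfactor] gives the same value for [w] and for the identity, whose [qfactor] terms
    are the q-binomial coefficients. *)
Lemma prod_qfactor_perm n (a : 'I_n -> nat) (F : fieldType) (q : F) (w : 'S_n) :
    (forall i, 0 < a i)%N -> q != 0 -> (forall m, (0 < m)%N -> q ^+ m != 1) ->
  (\prod_(i < n) ((1 - q ^+ sigma a i) / (1 - q ^+ sigma (a \o w) i))) *
  \prod_(i < n) qbinom q (sigma a i).-1 (a i).-1
  = \prod_i qfactor q (pos a (perm_order w) setT i) (a i).
Proof.
move=> a0 q0 q1.
have sig1 i : sigma a i = (pos a (perm_order 1) setT i + a i)%N.
  by have := sigma_perm a 1%g i; rewrite !perm1 => <-; apply: eq_bigr => k _;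
    rewrite /= perm1.
have nz : \prod_i (1 - q ^+ sigma (a \o w) i) != 0.
  apply/prodf_neq0 => i _; apply: one_subX_neq0 => //.
  by rewrite sigma_perm addn_gt0 a0 orbT.
apply: (mulfI nz); rewrite prod_one_sub_qfactor // big_split /= prodfV.
rewrite -(prod_one_sub_qfactor 1%g a0) //.
have -> : \prod_i (1 - q ^+ sigma (a \o (1%g : 'S_n)) i)
    = \prod_i (1 - q ^+ sigma a i).
  by apply: eq_bigr => i _; rewrite sigma_perm perm1 sig1.
have -> : \prod_(i < n) qbinom q (sigma a i).-1 (a i).-1
    = \prod_i qfactor q (pos a (perm_order 1) setT i) (a i).
  by apply: eq_bigr => i _; rewrite sig1 qbinom_qfactor.
by field.
Qed.

(** * Transitive tournaments and inversion sets *)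

Section SubsetTournament.
Variable n : nat.
Implicit Types (S : {set ltpair n}) (w : 'S_n) (i j : 'I_n).

(** Arrows go from the smaller to the larger index, except for the pairs in [S], which are
    reversed. *)
Definition tour S : rel 'I_n := fun i j =>
  if (i < j)%N then (i, j) \notin [set val p | p in S]
  else (j < i)%N && ((j, i) \in [set val p | p in S]).

Definition inversions w : {set ltpair n} := [set p | val p \in Rset w].

Lemma tour_irr S : irreflexive (tour S).
Proof. by move=> i; rewrite /tour ltnn. Qed.

Lemma tour_tot S i j : i != j -> tour S j i = ~~ tour S i j.
Proof.
rewrite -(inj_eq val_inj) /tour /= => ij.
by case: ltngtP ij => //= _ _; rewrite negbK.
Qed.

Lemma mem_Rset w i j :
  ((i, j) \in Rset w) = (i < j)%N && perm_order w j i.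
Proof.
apply/imsetP/andP => [[[k l]]|[ij wji]].
  by rewrite inE /= => /andP[kl wlk] [-> ->]; rewrite /perm_order !permK.
by exists ((w^-1)%g j, (w^-1)%g i); rewrite ?inE /= ?permKV // ij andbT.
Qed.

Lemma inversionsP w S : inversions w = S <-> tour S =2 perm_order w.
Proof.
split=> [<- i j|tE].
  have mem (k l : 'I_n) : (k < l)%N -> ((k, l) \in [set val p | p in inversions w])
      = perm_order w l k.
    move=> kl; apply/imsetP/idP => [[p]|lk].
      by rewrite inE => + E; rewrite -E mem_Rset => /andP[].
    by exists (Sub (k, l) kl); rewrite ?inE ?SubK // mem_Rset kl.
  rewrite /tour; case: ltngtP => [ij|ji|ij].
  - by rewrite mem // -perm_order_tot // -(inj_eq val_inj) /= (gtn_eqF ij).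
  - by rewrite mem.
  - by rewrite (val_inj ij) perm_order_irr.
apply/setP => p; rewrite inE; case: p => -[i j] /= ij.
rewrite mem_Rset ij -tE /tour ltnNge (ltnW ij) ij /=.
by rewrite -[(i, j)]/(val (Sub (i, j) ij : ltpair n)) mem_imset //; apply: val_inj.
Qed.

(** The preimage of [i] under [w] is recovered as its number of predecessors. *)
Lemma perm_order_inj w w' : perm_order w =2 perm_order w' -> w = w'.
Proof.
move=> E; apply: invg_inj; apply/permP => i; apply: val_inj.
have rank (v : 'S_n) : val ((v^-1)%g i) = (\sum_(j | perm_order v j i) 1)%N.
  rewrite (reindex_inj (@perm_inj _ v)) /=.
  under eq_bigl do rewrite /perm_order permK.
  by rewrite -(big_ord_widen n (fun=> 1%N) (ltnW (ltn_ord _))) sum1_card card_ord.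
by rewrite !rank; apply: eq_bigl => j; rewrite E.
Qed.

(** The indegree [r] increases strictly along arrows: by transitivity the tail's predecessors are
    also the head's, and the tail itself is one more. Hence [r] is a bijection onto ['I_n]. *)
Lemma trans_tour_perm S : trans_on (tour S) setT -> exists w, inversions w = S.
Proof.
move=> tS; pose r i := #|[set j | tour S j i]|.
have rlt i j : tour S i j -> (r i < r j)%N.
  move=> eij; apply: proper_card; apply/properP; split.
    by apply/subsetP => k; rewrite !inE => eki; apply: (tS i k j); rewrite ?inE.
  by exists i; rewrite !inE ?eij // tour_irr.
have rn i : (r i < n)%N.
  rewrite -[n in (_ < n)%N]card_ord -cardsT; apply: proper_card.
  by apply/properP; split; [apply: subsetT | exists i; rewrite ?inE ?tour_irr].
have rinj : injective (fun i => Ordinal (rn i)).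
  move=> i j [E]; apply/eqP/negP => /negP ij.
  have := rlt i j; have := rlt j i; rewrite (tour_tot S ij) E ltnn.
  by case: (tour S i j) => //= H1 H2; [have := H2 isT | have := H1 isT].
(* Ranks are values of the inverse of the permutation sought. *)
exists (perm rinj)^-1%g; apply/inversionsP => i j.
rewrite /perm_order invgK !permE /=; apply/idP/idP => [/rlt//|].
apply: contraTT => nij; rewrite -leqNgt.
have [->//|ij] := eqVneq i j; apply/ltnW/rlt.
by rewrite tour_tot.
Qed.

End SubsetTournament.

(** * Expansion over sets of reversed pairs *)

Section Expansion.
Variables (n : nat) (F : fieldType) (q : F) (R : comNzRingType).
Variables (phi : {rmorphism F -> R}) (a : 'I_n -> nat).
Hypothesis a_gt0 : forall i, (0 < a i)%N.

(** With [x y = 1], [(1 - x) y = - (1 - y)]; once [1 - x] is split off, which takes [a i > 0], the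
    remaining symbols are symmetric in the two indices. *)
Lemma lfactor_swap i j : lfactor q phi a i j * xratio R j i = - lfactor q phi a j i.
Proof.
rewrite /lfactor; set Q := _%:A.
case: (a i) (a_gt0 i) => // s _; case: (a j) (a_gt0 j) => // t _ /=.
rewrite !qpochS; have := xratioV R i j.
move: (xratio R i j) (xratio R j i) => x y xy.
set P := qpoch _ _ _; set P' := qpoch _ _ _.
transitivity ((y - x * y) * P * P'); first by ring.
by rewrite xy; ring.
Qed.

Lemma ltournament_tour (S : {set ltpair n}) :
  ltournament q phi a (tour S) = \prod_(p : ltpair n)
    (if p \in S then lfactor q phi a (val p).2 (val p).1
     else lfactor q phi a (val p).1 (val p).2).
Proof.
set B := lfactor q phi a.
rewrite /ltournament (pair_big_dep xpredT (tour S) B) /=.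
transitivity (\prod_(u : 'I_n * 'I_n | (u.1 < u.2)%N)
    (if tour S u.1 u.2 then B u.1 u.2 else B u.2 u.1)); last first.
  rewrite (reindex_omap (val : ltpair n -> _) insub) /=; last first.
    by move=> u lt; rewrite insubT.
  apply: eq_big => [[u lt]|[[i j] /= lt] _]; first by rewrite insubT lt /= eqxx.
  rewrite /tour lt -[(i, j)]/(val (Sub (i, j) lt : ltpair n)).
  by rewrite mem_imset ?if_neg //; apply: val_inj.
(* Arrows are split by whether they follow the order of the indices; those against it are reindexed
   by swapping their ends. *)
rewrite (bigID (fun u : 'I_n * 'I_n => u.1 < u.2)%N) /=.
rewrite [RHS](bigID (fun u : 'I_n * 'I_n => tour S u.1 u.2)) /=; congr (_ * _).
  by apply: eq_big => [u|u /andP[tu _]]; rewrite ?tu // andbC.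
pose swap (u : 'I_n * 'I_n) := (u.2, u.1).
rewrite (reindex_inj (inv_inj (_ : involutive swap))) /=; last by case.
have tourN i j : tour S j i -> tour S i j = false.
  have [->|ij] := eqVneq i j; first by rewrite tour_irr.
  by rewrite (tour_tot S ij) => /negbTE.
apply: eq_big => [[i j]|[i j] /andP[/tourN tij _]] /=; last by rewrite tij.
rewrite andbC -leqNgt leq_eqVlt (inj_eq (@ord_inj n)).
have [->|ij] := eqVneq i j; first by rewrite tour_irr ltnn.
by rewrite (tour_tot S ij).
Qed.

End Expansion.

(** * The indeterminate q and the final identity *)

Lemma qvar_neq0 : qvar != 0.
Proof. by rewrite tofrac_eq0 polyX_eq0. Qed.

Lemma qvar_nonroot m : (0 < m)%N -> qvar ^+ m != 1.
Proof.
move=> m0; rewrite -tofracXn -tofrac1 tofrac_eq.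
apply: contraTneq m0 => /(congr1 (fun p : {poly rat} => size p)).
by rewrite size_polyXn size_poly1 => -[->].
Qed.

Theorem theorem1p2 (n : nat) (a : 'I_n -> nat) :
  (1 <= n)%N -> (forall i, 0 < a i)%N ->
  let q : laurent n (coefring n) := (qcst n qvar)%:A in
  let x := @xratio n (coefring n) in
  CT (\prod_(p : ltpair n)
        let i := (val p).1 in
        let j := (val p).2 in
        qpoch (x i j) q (a i) * qpoch (q * x j i) q (a j).-1 *
        (1 - tvar p *: x j i))
  = W a * qcst n (\prod_(i < n) qbinom qvar (sigma a i).-1 (a i).-1).
Proof.
move=> _ a_gt0 q x.
pose phi : {rmorphism Qq -> coefring n} := @mpolyC #|ltpair n| Qq.
pose B := lfactor qvar phi a.
pose tS (S : {set ltpair n}) := \prod_(p in S) tvar p.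
(* By [lfactor_swap], the term [- t_ij x_j / x_i] reverses the arrow and leaves the coefficient
   [t_ij], the two signs cancelling. *)
have expand : \prod_(p : ltpair n)
    (B (val p).1 (val p).2 * (1 - tvar p *: x (val p).2 (val p).1))
    = \sum_(S : {set ltpair n}) tS S *: ltournament qvar phi a (tour S).
  transitivity (\prod_(p : ltpair n)
      (tvar p *: B (val p).2 (val p).1 + B (val p).1 (val p).2)).
    apply: eq_bigr => p _; rewrite mulrBr mulr1 addrC -scalerAr lfactor_swap //.
    by rewrite scalerN opprK.
  rewrite bigA_distr; apply: eq_big => [S|S _]; first by rewrite inE.
  have -> : tS S = \prod_p (if p \in S then tvar p else 1) by apply: big_mkcond.
  rewrite ltournament_tour -scaler_prod; apply: eq_bigr => p _.
  by case: ifP; rewrite ?scale1r.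
rewrite [\prod_(p : ltpair n) _]expand {expand}.
rewrite /CT raddf_sum /= /W mulr_suml.
(* Grouping permutations by inversion set turns both sides into sums over [S]. *)
rewrite (partition_big (@inversions n) xpredT) //=; apply: eq_bigr => S _.
rewrite [LHS]lcoef_is_scalable -/(CT _).
have [trans nontrans] := CT_ltournament qvar_neq0 qvar_nonroot phi a_gt0
  (@tour_irr n S) (@tour_tot n S).
(* If [S] is no inversion set, its tournament is not transitive: the constant term is 0 and the
   group of permutations is empty. Otherwise the group is a single [w]. *)
have [w /eqP wS|noS] := pickP (fun w => inversions w == S); last first.
  rewrite nontrans ?mulr0 ?big_pred0 // => /trans_tour_perm[w /eqP].
  by rewrite noS.
have tE := (inversionsP w S).1 wS.
rewrite (big_pred1 w) => [|w']; last first.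
  apply/eqP/eqP => [w'S|->//]; apply: perm_order_inj => i j.
  by rewrite -tE ((inversionsP w' S).1 w'S).
rewrite trans; last first.
  by move=> j i k jT iT kT; rewrite !tE; apply: perm_order_trans.
rewrite -mulrA; congr (_ * _); first by apply: eq_bigl => p; rewrite -wS inE.
transitivity (phi (\prod_i qfactor qvar (pos a (perm_order w) setT i) (a i))).
  congr (phi _); apply: eq_bigr => i _; congr qfactor.
  by apply: eq_bigl => j; rewrite tE.
rewrite -(prod_qfactor_perm w a_gt0 qvar_neq0 qvar_nonroot).
exact: (rmorphM phi).
Qed.
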